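(* Let $n>1$ and let $f:M\to L$ be a map of degree $k$ between closed oriented $2n$-manifolds. If the intersection form $X_M$ is even and $X_L$ is not even, then $k$ must be even.
   Context: All manifolds are closed, connected and orientable; (co)homology is with integer coefficients. $\bar H_n(M)$ denotes the free part of $H_n(M)$ (modulo torsion). The intersection form $X_M$ is the unimodular bilinear form given by cup product on $\bar H^n(M)$, equivalently (via Poincaré duality) by the intersection product $\cap$ on $\bar H_n(M)$. $X_M$ is called even if $x\cap x$ is even for every $x\in\bar H_n(M)$. *)

(* Defs.v *)
From HB Require Import structures.
From mathcomp Require Import all_boot all_order all_algebra.
From mathcomp Require Import all_classical all_reals topology normedtype.
From mathcomp Require Import freeg zify ring.

Set Implicit Arguments.
Unset Strict Implicit.
Unset Printing Implicit Defensive.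

Import Order.TTheory GRing.Theory Num.Theory numFieldNormedType.Exports.
Import Quotient.

Local Open Scope classical_set_scope.
Local Open Scope ring_scope.
Local Open Scope quotient_scope.

(* All chains and cochains are singular with integer coefficients; [R] is the
   field of reals.  Absolute homology H_k(X) is [homology R k set0], and maps on
   (co)homology classes are defined on the chosen representative [repr]; the
   lemmas with suffix [_pi] state that they do not depend on this choice. *)

Definition simplex (R : realType) (k : nat) : set 'rV[R]_k.+1 :=
  [set t | (forall i, 0 <= t ord0 i) /\ \sum_i t ord0 i = 1].
Arguments simplex R k : clear implicits.

Section AffineMaps.
Variables (R : realType) (p m : nat) (v : 'I_p.+1 -> 'I_m.+1).

Definition vertex_mx : 'M[R]_(p.+1, m.+1) := \matrix_(i, j) (v i == j)%:R.

Lemma vertex_mx_simplex (t : set_type (simplex R p)) :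
  val t *m vertex_mx \in simplex R m.
Proof.
case: t => t /= /set_mem [t0 t1]; apply/mem_set; split=> [j|].
  rewrite mxE; apply: sumr_ge0 => i _.
  by rewrite mxE mulr_ge0 ?t0 ?ler0n.
under eq_bigr do rewrite mxE.
rewrite exchange_big -[RHS]t1; apply: eq_bigr => i _ /=.
rewrite (bigD1 (v i)) //= big1 ?addr0 => [|j ji]; first by rewrite mxE eqxx mulr1.
by rewrite mxE eq_sym (negPf ji) mulr0.
Qed.

(* The affine map sending the vertex e_i to e_(v i). *)
Definition affine (t : set_type (simplex R p)) : set_type (simplex R m) :=
  exist _ (val t *m vertex_mx) (vertex_mx_simplex t).

Lemma vertex_mx_continuous : continuous (fun t : 'rV[R]_p.+1 => t *m vertex_mx).
Proof.
move=> t U [P nP PU].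
have Ft : Filter (nbhs t) by exact: nbhs_filter.
have cvg_coord i j : (s *m vertex_mx) i j @[s --> t] --> (t *m vertex_mx) i j.
  rewrite mxE; under eq_fun do rewrite mxE.
  apply: cvg_big => [|k _]; first exact: add_continuous.
  by apply: cvgM; [exact: coord_continuous | exact: cvg_cst].
have : \forall s \near nbhs t, forall i j, P i j ((s *m vertex_mx) i j).
  apply: (@filter_forall _ _ (fun i s => forall j, _) _ Ft) => i.
  apply: (@filter_forall _ _ (fun j s => _) _ Ft) => j.
  exact: (cvg_coord i j _ (nP i j)).
by apply: (@filterS _ _ Ft) => s Ps; apply: PU => i j; exact: Ps.
Qed.

Lemma affine_continuous : continuous affine.
Proof.
apply/continuous_comp_initial => t.
have -> : set_val \o affine = (fun t => t *m vertex_mx) \o set_val by [].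
apply: continuous_comp; last exact: vertex_mx_continuous.
exact: initial_continuous.
Qed.

HB.instance Definition _ := isContinuous.Build _ _ affine affine_continuous.

End AffineMaps.

Definition sing (R : realType) (k : nat) (X : topologicalType) :=
  continuousType (set_type (simplex R k)) X.
Arguments sing R k X : clear implicits.
Arguments affine R {p m} v.

(* The restriction of a singular simplex to the vertices v_0, ..., v_p. *)
Definition face (R : realType) (X : topologicalType) (p m : nat)
  (v : 'I_p.+1 -> 'I_m.+1) (s : sing R m X) : sing R p X := s \o affine R v.

Notation chain R k X := {freeg (sing R k X)}.
Notation cochain R k X := (sing R k X -> int).

Section Chains.
Variables (R : realType) (X : topologicalType).

(* In degree 0 the junk target C_0 stands for C_(-1) = 0: the map is zero. *)
Definition boundary (k : nat) : chain R k X -> chain R k.-1 X :=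
  match k with
  | 0 => fun=> 0
  | k.+1 => fglift (fun s : sing R k.+1 X => \sum_(i < k.+2) (-1) ^+ i *: << face (fintype.lift i) s >>)
  end.

(* c lies in C_k(A), seen as a subgroup of C_k(X). *)
Definition chain_in (A : set X) (k : nat) (c : chain R k X) : Prop :=
  {in dom c, forall s : sing R k X, range s `<=` A}.

(* Indexed by its target: C^(k-1) -> C^k, the zero map when k = 0. *)
Definition coboundary (k : nat) : cochain R k.-1 X -> cochain R k X :=
  match k with
  | 0 => fun=> 0
  | k.+1 => fun a (s : sing R k.+1 X) => \sum_(i < k.+2) (-1) ^+ i * a (face (fintype.lift i) s)
  end.

Definition pairing (k : nat) (a : cochain R k X) (c : chain R k X) : int :=
  fglift (a : sing R k X -> int^o) c.

(* Alexander-Whitney: front p-face times back q-face; meant for m = p + q. *)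
Definition cup_cochain (p q m : nat) (a : cochain R p X) (b : cochain R q X) :
    cochain R m X :=
  fun s => a (face (fun i => inord i) s) * b (face (fun j => inord (p + j)) s).

End Chains.

Definition push_chain (R : realType) (X Y : topologicalType)
    (f : continuousType X Y) (k : nat) : chain R k X -> chain R k Y :=
  fglift (fun s : sing R k X => << (f \o s : sing R k Y) >>).

Section Lemmas.
Variables (R : realType) (X : topologicalType).

Fact fglift_zmod (K : choiceType) (M : lmodType int) (f : K -> M) :
  zmod_morphism (fglift f : {freeg K} -> M).
Proof. exact: lift_is_additive. Qed.

HB.instance Definition _ (K : choiceType) (M : lmodType int) (f : K -> M) :=
  GRing.isZmodMorphism.Build _ _ (fglift f : {freeg K} -> M) (fglift_zmod f).

Lemma fglift_basis (K : choiceType) (M : lmodType int) (f : K -> M) k :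
  fglift f << k >> = f k.
Proof. by rewrite liftU scale1r. Qed.

Fact boundary_zmod k : zmod_morphism (@boundary R X k).
Proof. by case: k => [|k] x y; [rewrite subrr | rewrite /boundary raddfB]. Qed.
HB.instance Definition _ k :=
  GRing.isZmodMorphism.Build _ _ (@boundary R X k) (@boundary_zmod k).

Fact coboundary_zmod k : zmod_morphism (@coboundary R X k).
Proof.
case: k => [|k] x y; first by rewrite /= subrr.
apply/funext => s /=; rewrite !fctE /= -sumrB; apply: eq_bigr => i _.
by rewrite mulrBr.
Qed.
HB.instance Definition _ k :=
  GRing.isZmodMorphism.Build _ _ (@coboundary R X k) (@coboundary_zmod k).

Fact push_chain_zmod Y f k : zmod_morphism (@push_chain R X Y f k).
Proof. by move=> x y; rewrite /push_chain raddfB. Qed.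
HB.instance Definition _ Y f k :=
  GRing.isZmodMorphism.Build _ _ (@push_chain R X Y f k) (@push_chain_zmod Y f k).

Fact pairing_zmod k a : zmod_morphism (@pairing R X k a).
Proof. by move=> x y; rewrite /pairing raddfB. Qed.
HB.instance Definition _ k a :=
  GRing.isZmodMorphism.Build _ _ (@pairing R X k a) (@pairing_zmod k a).

Lemma freeg_ind (K : choiceType) (P : {freeg K} -> Prop) :
  P 0 -> (forall x, P << x >>) -> (forall x y, P x -> P y -> P (x - y)) ->
  forall x, P x.
Proof.
move=> P0 Pu PB x.
have PN y : P y -> P (- y) by rewrite -sub0r; exact: PB.
have PD y z : P y -> P z -> P (y + z).
  by move=> Py Pz; rewrite -[z]opprK; apply: PB => //; exact: PN.
rewrite -(freeg_sumE x); elim/big_ind: _ => // k _.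
have -> : << coeff k x *g k >> = << k >> *~ coeff k x :> {freeg K}.
  by rewrite freegU_mulz intz.
have Pn n : P (<< k >> *+ n).
  by elim: n => [|n IH]; rewrite ?mulr0n // mulrS; apply: PD.
case: (coeff k x) => n; first exact: Pn.
by rewrite NegzE mulrNz; apply: PN; exact: Pn.
Qed.

Lemma pairing_basis k (a : cochain R k X) s : pairing a << s >> = a s.
Proof. exact: (@fglift_basis _ int^o). Qed.

Lemma pairingZ k (a : cochain R k X) n c : pairing a (n *: c) = n * pairing a c.
Proof. by rewrite -[in LHS](intz n) scaler_int raddfMz -mulrzl intz. Qed.

Lemma pairing_coboundary k (a : cochain R k.-1 X) (c : chain R k X) :
  pairing (coboundary a) c = pairing a (boundary c).
Proof.
elim/freeg_ind: c => [|s|x y ex ey]; rewrite ?raddf0 ?raddfB //=; last by rewrite ex ey.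
rewrite pairing_basis; case: k a s => [|k] a s; first by rewrite raddf0.
rewrite /boundary fglift_basis raddf_sum; apply: eq_bigr => i _.
by apply: esym; apply: etrans (@pairingZ k a _ _) _; congr (_ * _); exact: pairing_basis.
Qed.

Lemma face_comp (l p m : nat) (v : 'I_p.+1 -> 'I_m.+1) (w : 'I_l.+1 -> 'I_p.+1)
  (s : sing R m X) : face w (face v s) = face (v \o w) s.
Proof.
apply/continuousEP => t /=; congr (s _); apply: val_inj => /=.
rewrite -mulmxA; congr (_ *m _); apply/matrixP => i j; rewrite !mxE /=.
rewrite (bigD1 (w i)) //= !mxE eqxx mul1r big1 ?addr0 // => k.
by rewrite eq_sym !mxE => /negPf ->; rewrite mul0r.
Qed.

Lemma coboundary_cup p q m (a : cochain R p X) (b : cochain R q X) s :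
  m = (p + q)%N ->
  @coboundary R X m.+1 (cup_cochain a b) s =
    cup_cochain (@coboundary R X p.+1 a) b s
    + (-1) ^+ p * cup_cochain a (@coboundary R X q.+1 b) s.
Proof.
move=> em; subst m; rewrite /cup_cochain /=.
have faceE (l k : nat) (v w : 'I_l.+1 -> 'I_k.+1) s' : v =1 w ->
  face v s' = face w s' :> sing R l X by move/funext ->.
pose F i := a (face (fun j : 'I_p.+1 => inord (bump i j)) s) *
  b (face (fun j : 'I_q.+1 => inord (bump i (p + j))) s) : int.
transitivity (\sum_(i < (p + q).+2) (-1) ^+ i * F i).
  apply: eq_bigr => i _; rewrite !face_comp /F; congr (_ * (a _ * b _));
    apply: faceE => j; apply: val_inj => /=.
    rewrite !inordK //; last first; move: (ltn_ord j) (ltn_ord i); rewrite /bump; lia.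
  rewrite !inordK //; last first; move: (ltn_ord j) (ltn_ord i); rewrite /bump; lia.
pose G i := a (face (fun j : 'I_p.+1 => inord j) s) *
  b (face (fun j : 'I_q.+1 => inord (p + bump i j)) s) : int.
pose H i := a (face (fun j : 'I_p.+1 => inord (bump i j)) s) *
  b (face (fun j : 'I_q.+1 => inord (p.+1 + j)) s) : int.
have -> : (\sum_(i < p.+2) (-1) ^+ i * a (face (fintype.lift i)
    (face (fun i => inord i) s))) * b (face (fun j : 'I_q.+1 => inord (p.+1 + j)) s)
  = \sum_(i < p.+2) (-1) ^+ i * H i.
  rewrite mulr_suml; apply: eq_bigr => i _; rewrite -mulrA /H face_comp.
  congr (_ * (a _ * _)); apply: faceE => j; apply: val_inj => /=.
have -> : (-1) ^+ p * (a (face (fun j : 'I_p.+1 => inord j) s) *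
    \sum_(i < q.+2) (-1) ^+ i * b (face (fintype.lift i)
    (face (fun j => inord (p + j)) s)))
  = \sum_(i < q.+2) (-1) ^+ (p + i) * G i.
  rewrite !mulr_sumr; apply: eq_bigr => i _.
  by rewrite exprD /G face_comp; set x := a _; set y := b _; ring.
rewrite [X in _ = X + _]big_ord_recr /= [in X in _ = _ + X]big_ord_recl /=.
rewrite addn0 exprS mulN1r.
have -> : H p.+1 = G 0%N.
  rewrite /H /G; congr (a _ * b _); apply: faceE => j; congr inord;
  by move: (ltn_ord j); rewrite /bump; lia.
rewrite addrA mulNr addrNK.
have -> : (p + q).+2 = (p.+1 + q.+1)%N by lia.
rewrite big_split_ord /=; congr (_ + _); apply: eq_bigr => i _.
  congr (_ * (_ * b _)); apply: faceE => j; congr inord.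
  by move: (ltn_ord i); rewrite /bump; lia.
rewrite /bump /= addSn addnS; congr (_ * (a _ * b _));
  apply: faceE => j; congr inord; move: (ltn_ord j); rewrite /bump; lia.
Qed.

End Lemmas.

Section Homology.
Variables (R : realType) (k : nat) (X : topologicalType) (A : set X).

Fact chain_in_zmod j :
  zmod_closed (fun c : chain R j X => `[< chain_in A c >]).
Proof.
split=> [|c d /asboolP cA /asboolP dA]; apply/asboolP => s; rewrite ?dom0 //.
by move=> /domB; rewrite mem_cat => /orP[/cA|/dA].
Qed.

Lemma chain_in0 j : chain_in A (0 : chain R j X).
Proof. exact/asboolP/(chain_in_zmod j).1. Qed.

Lemma chain_inB j (c d : chain R j X) :
  chain_in A c -> chain_in A d -> chain_in A (c - d).
Proof.
by move=> /asboolP cA /asboolP dA; apply/asboolP; apply: (chain_in_zmod j).2.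
Qed.

Definition is_cycle (z : chain R k X) : bool := `[< chain_in A (boundary z) >].

Fact is_cycle_zmod : zmod_closed is_cycle.
Proof.
split=> [|c d /asboolP zc /asboolP zd]; apply/asboolP; rewrite ?raddf0 ?raddfB.
  exact: chain_in0.
exact: chain_inB.
Qed.
HB.instance Definition _ := GRing.isZmodClosed.Build _ is_cycle is_cycle_zmod.

Record cycle := Cycle { cycle_val : chain R k X; _ : is_cycle cycle_val }.
HB.instance Definition _ := [isSub for cycle_val].
HB.instance Definition _ := [Choice of cycle by <:].
HB.instance Definition _ := [SubChoice_isSubZmodule of cycle by <:].

(* z lies in B_k(X) + C_k(A). *)
Definition is_boundary (z : cycle) : bool :=
  `[< exists b : chain R k.+1 X, chain_in A (val z - boundary b) >].

Fact is_boundary_zmod : zmod_closed is_boundary.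
Proof.
split=> [|c d /asboolP[b cb] /asboolP[b' db]]; apply/asboolP.
  by exists 0; rewrite !raddf0 addr0; exact: chain_in0.
exists (b - b'); have -> : val (c - d) - boundary (b - b') =
    (val c - boundary b) - (val d - boundary b').
  by rewrite (raddfB val) (raddfB (@boundary R X k.+1)) opprD addrACA -opprD.
exact: chain_inB.
Qed.
HB.instance Definition _ := GRing.isZmodClosed.Build _ is_boundary is_boundary_zmod.

Definition homology : zmodType := {quot (GRing.ZmodClosed.clone _ is_boundary _)}.

End Homology.

Arguments homology R k {X} A.

Section HomologyMap.
Variables (R : realType) (k : nat) (X Y : topologicalType).
Variables (A : set X) (B : set Y) (f : continuousType X Y).
Hypothesis fAB : f @` A `<=` B.

Lemma push_chain_basis j (s : sing R j X) :
  push_chain f << s >> = << (f \o s : sing R j Y) >>.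
Proof. exact: fglift_basis. Qed.

Lemma push_chainZ j n (c : chain R j X) : push_chain f (n *: c) = n *: push_chain f c.
Proof. by rewrite -(intz n) !scaler_int raddfMz. Qed.

Lemma boundary_push j (c : chain R j X) :
  boundary (push_chain f c) = push_chain f (boundary c).
Proof.
elim/freeg_ind: c => [|s|x y ex ey]; rewrite ?raddf0 //; last first.
  by rewrite !raddfB /= ex ey.
rewrite push_chain_basis; case: j s => [|j] s; first by rewrite raddf0.
rewrite /boundary !fglift_basis raddf_sum; apply: eq_bigr => i _.
apply: esym; apply: etrans (push_chainZ _ _) _; congr (_ *: _).
by apply: etrans (push_chain_basis _) _; congr (<< _ >>); apply/continuousEP.
Qed.

Lemma chain_in_push j (c : chain R j X) : chain_in A c -> chain_in B (push_chain f c).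
Proof.
move=> cA; rewrite -(freeg_sumE c) raddf_sum big_seq.
elim/big_ind: _ => [|x y xB yB|s sc]; first exact: chain_in0.
  by rewrite -[y]opprK; apply: chain_inB => //; rewrite -sub0r;
     apply: chain_inB => //; exact: chain_in0.
move=> t; rewrite /= /push_chain liftU -[coeff _ _]intz scaler_int freegU_mulz.
rewrite mem_dom coeffU; case: (eqVneq _ t) => [<- _ _ [x _ <-]|]; last by rewrite mulr0 eqxx.
by apply: fAB; exists (s x) => //; apply: (cA _ sc); exists x.
Qed.

Fact push_cycle (z : cycle R k A) : is_cycle B (push_chain f (val z)).
Proof.
by case: z => z /= /asboolP zA; apply/asboolP; rewrite boundary_push; exact: chain_in_push.
Qed.

Definition homology_map (h : homology R k A) : homology R k B :=
  \pi_(homology R k B) (Cycle (push_cycle (repr h))).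

Lemma homology_map_pi (z : cycle R k A) :
  homology_map (\pi z) = \pi_(homology R k B) (Cycle (push_cycle z)).
Proof.
apply/eqP; rewrite piE /=; apply/asboolP.
have : repr (\pi_(homology R k A) z) == z %[mod homology R k A] by rewrite reprK.
rewrite piE => /asboolP[b bA]; exists (push_chain f b).
rewrite boundary_push (raddfB val) /= -!raddfB; exact: chain_in_push.
Qed.
End HomologyMap.

Section Cohomology.
Variables (R : realType) (k : nat) (X : topologicalType).

Definition is_cocycle (a : cochain R k X) : bool :=
  `[< @coboundary R X k.+1 a = 0 >].

Fact is_cocycle_zmod : zmod_closed is_cocycle.
Proof.
split=> [|a b /asboolP za /asboolP zb]; apply/asboolP; rewrite ?raddf0 //.
apply: etrans (raddfB (@coboundary R X k.+1) a b) _.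
by rewrite [X in X - _]za [X in _ - X]zb subrr.
Qed.
HB.instance Definition _ := GRing.isZmodClosed.Build _ is_cocycle is_cocycle_zmod.

Record cocycle := Cocycle { cocycle_val : cochain R k X; _ : is_cocycle cocycle_val }.
HB.instance Definition _ := [isSub for cocycle_val].
HB.instance Definition _ := [Choice of cocycle by <:].
HB.instance Definition _ := [SubChoice_isSubZmodule of cocycle by <:].

Definition is_coboundary (a : cocycle) : bool :=
  `[< exists b : cochain R k.-1 X, val a = coboundary b >].

Fact is_coboundary_zmod : zmod_closed is_coboundary.
Proof.
split=> [|a b /asboolP[a' ea] /asboolP[b' eb]]; apply/asboolP.
  by exists 0; rewrite !raddf0.
exists (a' - b'); apply: etrans (raddfB val a b) _; apply: esym.
by apply: etrans (raddfB (@coboundary R X k) a' b') _; congr (_ - _).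
Qed.
HB.instance Definition _ :=
  GRing.isZmodClosed.Build _ is_coboundary is_coboundary_zmod.

Definition cohomology : zmodType := {quot (GRing.ZmodClosed.clone _ is_coboundary _)}.

End Cohomology.

Section Products.
Variables (R : realType) (X : topologicalType).

Fact cup_cocycle p q (a : cocycle R p X) (b : cocycle R q X) :
  is_cocycle (cup_cochain (val a) (val b) : cochain R (p + q) X).
Proof.
case: a b => a /= /asboolP a0 [b /= /asboolP b0]; apply/asboolP/funext => s.
have z0 j (s' : sing R j X) : (0 : cochain R j X) s' = 0 by [].
by rewrite coboundary_cup // /cup_cochain a0 b0 !z0 mul0r mulr0 mulr0.
Qed.

Definition cup p q (x : cohomology R p X) (y : cohomology R q X) :
    cohomology R (p + q) X :=
  \pi_(cohomology R (p + q) X) (Cocycle (cup_cocycle (repr x) (repr y))).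

Definition kronecker k (x : cohomology R k X) (h : homology R k (set0 : set X)) : int :=
  pairing (val (repr x)) (val (repr h)).

End Products.

Section FreePart.
Variable V : zmodType.

Definition is_torsion (x : V) : bool := `[< exists2 m, (0 < m)%N & x *+ m = 0 >].

Fact is_torsion_zmod : zmod_closed is_torsion.
Proof.
split=> [|x y /asboolP[m m0 xm] /asboolP[l l0 yl]]; apply/asboolP.
  by exists 1%N.
exists (m * l)%N; first by rewrite muln_gt0 m0.
by rewrite mulrnBl mulrnA xm mul0rn mulnC mulrnA yl mul0rn subrr.
Qed.
HB.instance Definition _ := GRing.isZmodClosed.Build _ is_torsion is_torsion_zmod.

Definition free_part : zmodType := {quot (GRing.ZmodClosed.clone _ is_torsion _)}.

End FreePart.

Section WellDefined.
Variables (R : realType) (X : topologicalType).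

Lemma pi_homologyP k (A : set X) (z w : cycle R k A) :
  z = w %[mod homology R k A] <->
  exists b : chain R k.+1 X, chain_in A (val z - val w - boundary b).
Proof.
split=> [/eqP|[b zw]]; last apply/eqP; rewrite piE.
  by move=> /asboolP[b]; rewrite (raddfB val); exists b.
by apply/asboolP; exists b; rewrite (raddfB val).
Qed.

Lemma pi_cohomologyP k (a b : cocycle R k X) :
  a = b %[mod cohomology R k X] <->
  exists c : cochain R k.-1 X, val a - val b = coboundary c.
Proof.
split=> [/eqP|[c ab]]; last apply/eqP; rewrite piE.
  by move=> /asboolP[c]; rewrite (raddfB val); exists c.
by apply/asboolP; exists c; rewrite (raddfB val).
Qed.

Lemma chain_in_set0 k (c : chain R k X) : chain_in set0 c -> c = 0.
Proof.
move=> c0; apply/eqP; rewrite -dom_eq0; case E: (dom c) => [//|s r].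
have sc : s \in dom c by rewrite E mem_head.
have e0 : delta_mx ord0 ord0 \in simplex R k.
  apply/mem_set; split=> [i|]; first by rewrite mxE ler0n.
  rewrite (bigD1 ord0) //= mxE eqxx big1 ?addr0 // => i.
  by rewrite mxE eqxx => /negPf ->.
pose e : set_type (simplex R k) := exist (fun t => t \in simplex R k) _ e0.
by case: (c0 s sc (s e)); exists e.
Qed.

Lemma pairingDl k (a b : cochain R k X) c :
  pairing (a + b) c = pairing a c + pairing b c.
Proof.
elim/freeg_ind: c => [|s|x y ex ey]; first by rewrite !raddf0.
  by rewrite !pairing_basis.
by rewrite !raddfB /= ex ey opprD addrACA.
Qed.

Lemma pairingBl k (a b : cochain R k X) c :
  pairing (a - b) c = pairing a c - pairing b c.
Proof. by apply/eqP; rewrite eq_sym subr_eq -pairingDl subrK. Qed.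

Lemma kronecker_pi k (a : cocycle R k X) (z : cycle R k (set0 : set X)) :
  kronecker (\pi_(cohomology R k X) a) (\pi_(homology R k set0) z) =
  pairing (val a) (val z).
Proof.
have /pi_cohomologyP[c] := reprK (\pi_(cohomology R k X) a).
have /pi_homologyP[b /chain_in_set0] := reprK (\pi_(homology R k set0) z).
rewrite /kronecker; move: (repr _) (repr _) => a' w /subr0_eq wz aa'.
apply/eqP; rewrite -subr_eq0; apply/eqP.
transitivity (pairing (val a' - val a) (val w) + pairing (val a) (val w - val z)).
  by rewrite pairingBl raddfB /= addrA subrK.
rewrite aa' wz pairing_coboundary.
have -> : boundary (val w) = 0.
  by case: (w) => ? /= /asboolP /chain_in_set0.
have a0 : @coboundary R X k.+1 (val a) = 0 by case: (a) => ? /= zx; exact/asboolP.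
rewrite raddf0 add0r; apply: etrans (esym (@pairing_coboundary R X k.+1 (val a) b)) _; rewrite a0.
by elim/freeg_ind: b {wz} => [|s|x y ex ey];
  rewrite ?raddf0 ?pairing_basis // raddfB /= ex ey.
Qed.

Lemma cup_coboundaryl p q m (a : cochain R p.-1 X) (b : cocycle R q X) :
  m = (p + q)%N -> exists c : cochain R m.-1 X,
    cup_cochain (coboundary a) (val b) = coboundary c.
Proof.
case: p a => [|p] a ->; first by exists 0; rewrite raddf0; apply/funext => s; exact: mul0r.
exists (cup_cochain a (val b)); apply/funext => s.
apply: esym; apply: etrans (@coboundary_cup R X p q _ _ _ _ erefl) _.
have b0 : @coboundary R X q.+1 (val b) = 0 by case: (b) => ? /= zx; exact/asboolP.
 rewrite {2}/cup_cochain b0.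
by rewrite (mulr0 (a _)) mulr0 addr0.
Qed.

Lemma cup_coboundaryr p q m (a : cocycle R p X) (b : cochain R q.-1 X) :
  m = (p + q)%N -> exists c : cochain R m.-1 X,
    cup_cochain (val a) (coboundary b) = coboundary c.
Proof.
case: q b => [|q] b; first by exists 0; rewrite raddf0; apply/funext => s; exact: mulr0.
rewrite addnS; case: m => // m [em].
exists (fun s => (-1) ^+ p * cup_cochain (val a) b s); apply/funext => s.
transitivity ((-1) ^+ p * @coboundary R X m.+1 (cup_cochain (val a) b) s).
  rewrite coboundary_cup //.
  have a0 : @coboundary R X p.+1 (val a) = 0 by case: (a) => ? /= zx; exact/asboolP.
  rewrite {2}/cup_cochain a0 (mul0r (b _)) add0r mulrA -exprD addnn.
  by rewrite -signr_odd odd_double mul1r.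
by rewrite /= mulr_sumr; apply: eq_bigr => i _; rewrite mulrCA.
Qed.

Lemma cup_pi p q (a : cocycle R p X) (b : cocycle R q X) :
  cup (\pi_(cohomology R p X) a) (\pi_(cohomology R q X) b) =
  \pi_(cohomology R (p + q) X) (Cocycle (cup_cocycle a b)).
Proof.
have /pi_cohomologyP[c] := reprK (\pi_(cohomology R p X) a).
have /pi_cohomologyP[d] := reprK (\pi_(cohomology R q X) b).
rewrite /cup; move: (repr _) (repr _) => a' b' bb' aa'.
apply/pi_cohomologyP => /=.
have [c' ec] := cup_coboundaryl c b' (erefl (p + q)%N).
have [d' ed] := cup_coboundaryr a d (erefl (p + q)%N).
exists (c' + d'); apply: esym; apply: etrans (raddfD (@coboundary R X (p + q)) _ _) _.
transitivity (cup_cochain (coboundary c) (val b') +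
    cup_cochain (val a) (coboundary d) : cochain R (p + q) X).
  by congr (_ + _); exact/esym.
rewrite -aa' -bb'; apply/funext => s.
pose f := face (fun i : 'I_p.+1 => inord i) s.
pose g := face (fun j : 'I_q.+1 => inord (p + j)) s.
suff : (val a' f - val a f) * val b' g + val a f * (val b' g - val b g) =
  val a' f * val b' g - val a f * val b g by [].
by ring.
Qed.

End WellDefined.

Section Bilinearity.
Variables (R : realType) (X : topologicalType).

Lemma homologyW k (A : set X) (P : homology R k A -> Prop) :
  (forall z : cycle R k A, P (\pi_(homology R k A) z)) -> forall h, P h.
Proof. by move=> H h; rewrite -[h]reprK; exact: H. Qed.

Lemma cohomologyW k (P : cohomology R k X -> Prop) :
  (forall a : cocycle R k X, P (\pi_(cohomology R k X) a)) -> forall x, P x.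
Proof. by move=> H x; rewrite -[x]reprK; exact: H. Qed.

Lemma kroneckerBl k (h : homology R k (set0 : set X)) :
  zmod_morphism (fun x : cohomology R k X => kronecker x h).
Proof.
elim/homologyW: h => z; elim/cohomologyW => a; elim/cohomologyW => b.
rewrite -(raddfB (\pi_(cohomology R k X))) !kronecker_pi.
by rewrite (raddfB val) pairingBl.
Qed.

Lemma kroneckerBr k (x : cohomology R k X) :
  zmod_morphism (fun h : homology R k (set0 : set X) => kronecker x h).
Proof.
elim/cohomologyW: x => a; elim/homologyW => z; elim/homologyW => w.
rewrite -(raddfB (\pi_(homology R k set0))) !kronecker_pi.
by rewrite (raddfB val) raddfB.
Qed.

Lemma cupBl p q (y : cohomology R q X) : zmod_morphism (fun x : cohomology R p X => cup x y).
Proof.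
elim/cohomologyW: y => b; elim/cohomologyW => a; elim/cohomologyW => a'.
rewrite -(raddfB (\pi_(cohomology R p X))) !cup_pi.
rewrite -(raddfB (\pi_(cohomology R (p + q) X))); congr (\pi_(_) _).
by apply: val_inj; apply/funext => s; exact: mulrBl.
Qed.

Lemma cupBr p q (x : cohomology R p X) : zmod_morphism (fun y : cohomology R q X => cup x y).
Proof.
elim/cohomologyW: x => a; elim/cohomologyW => b; elim/cohomologyW => b'.
rewrite -(raddfB (\pi_(cohomology R q X))) !cup_pi.
rewrite -(raddfB (\pi_(cohomology R (p + q) X))); congr (\pi_(_) _).
by apply: val_inj; apply/funext => s; exact: mulrBr.
Qed.

Lemma zmod_morphism_torsion (V : zmodType) (g : V -> int) x :
  zmod_morphism g -> is_torsion x -> g x = 0.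
Proof.
move=> gB /asboolP[m m0 xm].
pose G := GRing.isZmodMorphism.Build _ _ g gB.
pose g' : {additive V -> int} := HB.pack g G.
have : g' x *+ m = 0 by rewrite -raddfMn xm raddf0.
by move/eqP; rewrite mulrn_eq0 eqn0Ngt m0 /= => /eqP.
Qed.
End Bilinearity.

Definition locally_euclidean (R : realType) (d : nat) (X : topologicalType) :=
  forall x : X, exists (U : set X) (phi : X -> 'rV[R]_d) (psi : 'rV[R]_d -> X),
    [/\ open U /\ U x, open (phi @` U), {within U, continuous phi},
        {within phi @` U, continuous psi} & {in U, cancel phi psi}].

Definition generates (V : zmodType) (g : V) := forall v : V, exists m : int, v = g *~ m.

Fact image_set0_sub (X Y : Type) (f : X -> Y) (B : set Y) : f @` set0 `<=` B.
Proof. by rewrite image_set0. Qed.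

(* Induced by the inclusion of pairs (X, set0) -> (X, X - x). *)
Definition localize (R : realType) (k : nat) (X : topologicalType) (x : X) :
    homology R k (set0 : set X) -> homology R k (~` [set x]) :=
  homology_map (f := idfun) (@image_set0_sub _ _ _ _).

(* Closed, connected, topological d-manifolds.  The orientation is given by the
   fundamental class [M] in H_d(M), a class that restricts at every point x to a
   generator of the local homology group H_d(M, M - x). *)
Record oriented_manifold (R : realType) (d : nat) := OrientedManifold {
  manifold_space :> topologicalType;
  manifold_nonempty : [set: manifold_space] !=set0;
  manifold_hausdorff : hausdorff_space manifold_space;
  manifold_second_countable : @second_countable manifold_space;
  manifold_euclidean : locally_euclidean R d manifold_space;
  manifold_compact : compact [set: manifold_space];
  manifold_connected : connected [set: manifold_space];
  fundamental_class : homology R d (set0 : set manifold_space);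
  fundamental_classP : forall x, generates (localize x fundamental_class) }.

Definition pushforward (R : realType) (k : nat) (X Y : topologicalType)
    (f : continuousType X Y) :
    homology R k (set0 : set X) -> homology R k (set0 : set Y) :=
  homology_map (f := f) (@image_set0_sub _ _ _ _).

Definition has_degree (R : realType) (d : nat) (M L : oriented_manifold R d)
    (f : continuousType M L) (k : int) : Prop :=
  pushforward f (fundamental_class M) = fundamental_class L *~ k.

(* On H^n(M) modulo torsion, (x, y) |-> <x cup y, [M]>; the dimension 2n is
   written n + n so that it is the degree of the cup product. *)
Definition intersection_form (R : realType) (n : nat)
    (M : oriented_manifold R (n + n)) (x y : free_part (cohomology R n M)) : int :=
  kronecker (cup (repr x) (repr y)) (fundamental_class M).

Definition even_form (V : zmodType) (b : V -> V -> int) : Prop :=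
  forall x, (2 %| b x x)%Z.

Lemma intersection_form_pi (R : realType) (n : nat) (M : oriented_manifold R (n + n))
    (x y : cohomology R n M) :
  intersection_form (\pi_(free_part _) x) (\pi_(free_part _) y) =
  kronecker (cup x y) (fundamental_class M).
Proof.
have rt z : is_torsion (repr (\pi_(free_part (cohomology R n M)) z) - z).
  by have /eqP := reprK (\pi_(free_part (cohomology R n M)) z); rewrite piE.
rewrite /intersection_form; set x' := repr _; set y' := repr _.
apply/eqP; rewrite -subr_eq0; apply/eqP.
transitivity (kronecker (cup (x' - x) y') (fundamental_class M) +
    kronecker (cup x (y' - y)) (fundamental_class M)).
  by rewrite cupBl cupBr !kroneckerBl addrA subrK.
rewrite (@zmod_morphism_torsion _ (fun u => kronecker (cup u y') (fundamental_class M))).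
- rewrite add0r (@zmod_morphism_torsion _
    (fun u => kronecker (cup x u) (fundamental_class M))) ?rt // => u v.
  by rewrite cupBr kroneckerBl.
- by move=> u v; rewrite cupBl kroneckerBl.
- exact: rt.
Qed.

(* Main.v *)
(* Evaluating on the fundamental classes, the projection formula gives
   <f^*x cup f^*x, [M]> = <x cup x, f_*[M]> = k <x cup x, [L]> for x in H^n(L).
   The left side is even, and some x makes <x cup x, [L]> odd. *)

From HB Require Import structures.
Require Import Defs.
From mathcomp Require Import all_boot all_order all_algebra.
From mathcomp Require Import all_classical all_reals topology.
From mathcomp Require Import freeg.

Import GRing.Theory.
Local Open Scope ring_scope.
Local Open Scope quotient_scope.

Section Pullback.
Context {R : realType} {X Y : topologicalType} (f : continuousType X Y).

Definition pull_cochain {k} (a : cochain R k Y) : cochain R k X :=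
  fun s => a (f \o s : sing R k Y).

Lemma face_comp_map {p m} (v : 'I_p.+1 -> 'I_m.+1) (s : sing R m X) :
  face v (f \o s : sing R m Y) = (f \o face v s : sing R p Y).
Proof. exact/continuousEP. Qed.

Lemma coboundary_pull k (a : cochain R k Y) :
  @coboundary R X k.+1 (pull_cochain a) =
  pull_cochain (@coboundary R Y k.+1 a).
Proof.
apply/funext => s; rewrite /pull_cochain /=.
by apply: eq_bigr => i _; rewrite face_comp_map.
Qed.

(** Naturality is an equality of cochains, not only of classes: the Alexander-Whitney product
    restricts to front and back faces, and taking faces commutes with composing by [f]. *)
Lemma cup_cochain_pull p q m (a : cochain R p Y) (b : cochain R q Y) :
  cup_cochain (pull_cochain a) (pull_cochain b) =
  pull_cochain (cup_cochain a b : cochain R m Y).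
Proof.
by apply/funext => s; rewrite /cup_cochain /pull_cochain !face_comp_map.
Qed.

Lemma pairing_pull k (a : cochain R k Y) (c : chain R k X) :
  pairing (pull_cochain a) c = pairing a (push_chain f c).
Proof.
elim/freeg_ind: c => [|s|x y ex ey]; rewrite ?raddf0 //.
  by rewrite push_chain_basis !pairing_basis.
by rewrite !raddfB /= ex ey.
Qed.

Fact pull_cocycle_subproof {k} (a : cocycle R k Y) :
  is_cocycle (pull_cochain (val a)).
Proof.
case: a => a /= /asboolP a0; apply/asboolP.
by rewrite coboundary_pull a0.
Qed.

Definition pull_cocycle {k} (a : cocycle R k Y) : cocycle R k X :=
  Cocycle (pull_cocycle_subproof a).

(** The projection formula. With representatives chosen on both sides it reduces to naturality of
    the cup product and adjointness of [pull_cochain] and [push_chain]. *)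
Lemma kronecker_cup_pull p q (a : cocycle R p Y) (b : cocycle R q Y)
    (h : homology R (p + q) (set0 : set X)) :
  kronecker (cup (\pi_(cohomology R p X) (pull_cocycle a))
                 (\pi_(cohomology R q X) (pull_cocycle b))) h =
  kronecker (cup (\pi_(cohomology R p Y) a) (\pi_(cohomology R q Y) b))
            (pushforward f h).
Proof.
elim/homologyW: h => z.
rewrite !cup_pi /pushforward homology_map_pi !kronecker_pi /=.
by rewrite cup_cochain_pull pairing_pull.
Qed.

End Pullback.

Lemma kroneckerMz (R : realType) (X : topologicalType) k (x : cohomology R k X)
    (h : homology R k (set0 : set X)) (m : int) :
  kronecker x (h *~ m) = kronecker x h * m.
Proof.
pose g : {additive homology R k (set0 : set X) -> int} :=
  HB.pack (kronecker x) (GRing.isZmodMorphism.Build _ _ _ (kroneckerBr x)).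
by rewrite -[LHS]/(g (h *~ m)) raddfMz -mulrzr intz.
Qed.

Theorem corollary4 (R : realType) (n : nat) (hn : (1 < n)%N)
    (M L : oriented_manifold R (n + n)) (f : continuousType M L) (k : int)
    (hf : has_degree f k)
    (hM : even_form (@intersection_form R n M))
    (hL : ~ even_form (@intersection_form R n L)) :
  (2 %| k)%Z.
Proof.
have [x xodd] : exists x, ~ (2 %| @intersection_form R n L x x)%Z.
  by apply: contrapT => noodd; apply: hL => x; apply: contrapT => ?; apply: noodd; exists x.
(* The inner [repr] lifts [x] from the free part to a cohomology class, the outer one to a cocycle,
   which can be pulled back. *)
pose a := repr (repr x).
have := hM (\pi_(free_part _) (\pi_(cohomology R n M) (pull_cocycle f a))).
rewrite intersection_form_pi kronecker_cup_pull hf kroneckerMz /a reprK.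
(* The pairing left on [L] is the form at [x], since [intersection_form] is defined through
   [repr x]. As 2 is prime, it divides this odd value or [k]. *)
rewrite -/(intersection_form x x) !dvdzE abszM Euclid_dvdM //.
by case/orP => // x2; case: xodd; rewrite dvdzE.
Qed.
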